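(* For every integer $n\ge 4$, $\mathrm{fr}(n)=12n-16$; that is, from any collection of $12n-16$ colored cubes (arbitrary varieties, repetitions allowed) one can always build the frame of an $n\times n\times n$ cube.
   Context: Fix a palette of six colors. A colored cube is a unit cube each of whose six faces is painted with a single color, every one of the six colors appearing on some face. Two colored cubes are of the same variety if one can be rigidly rotated onto the other with colors matching; there are exactly $30$ varieties. The frame of an $n\times n\times n$ cube consists of the $12(n-2)+8=12n-16$ unit positions lying on its edges (corners included); building a frame means placing colored cubes into all these positions so that, on each of the six outer faces of the big cube, all visible unit faces have one common color. $\mathrm{fr}(n)$ denotes the smallest number $N$ such that from any collection of $N$ colored cubes one can select cubes to build an $n\times n\times n$ frame. *)

(* Defs.v *)
From mathcomp Require Import all_boot all_fingroup.

Set Implicit Arguments.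
Unset Strict Implicit.
Unset Printing Implicit Defensive.

Definition color : Type := 'I_6.

(* (i, true) is the face with outward normal e_i, (i, false) the one with
   outward normal - e_i. *)
Definition face : Type := ('I_3 * bool)%type.

(* A colored cube together with the way it currently sits in space. *)
Definition cube : Type :=
  {c : {ffun face -> color} | [forall k : color, exists f : face, c f == k]}.

Definition face_color (c : cube) (f : face) : color := val c f.

(* A symmetry of the cube is a signed permutation matrix, mapping e_i to
   (-1)^(r.2 i) e_(r.1 i). *)
Definition symmetry : Type := ('S_3 * {ffun 'I_3 -> bool})%type.

Definition move_face (r : symmetry) (f : face) : face :=
  (r.1 f.1, f.2 (+) r.2 f.1).

(* The determinant of the signed permutation matrix is
   (-1)^(r.1) * \prod_i (-1)^(r.2 i); rotations are those of determinant 1. *)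
Definition rotation (r : symmetry) : bool :=
  ~~ (odd_perm r.1 (+) \big[addb/false]_(i < 3) r.2 i).

Definition same_variety (c c' : cube) : bool :=
  [exists r : symmetry,
    rotation r && [forall f, face_color c' (move_face r f) == face_color c f]].

Definition position (n : nat) : Type := {ffun 'I_3 -> 'I_n}.

Definition on_outer_face n (d : face) (p : position n) : bool :=
  p d.1 == (if d.2 then n.-1 else 0) :> nat.

(* A unit position lies on an edge of the big cube (possibly at a corner) when
   at least two of its three coordinates are extremal. *)
Definition on_edge n (p : position n) : bool :=
  2 <= #|[set i : 'I_3 | (p i == 0 :> nat) || (p i == n.-1 :> nat)]|.

Definition frame (n : nat) : Type := {p : position n | on_edge p}.

(* s selects distinct members of the collection, and q is how they are turned
   once put in place.  Only the unit faces lying on the outer faces of the big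
   cube are constrained, and nothing is asked of colors of different outer
   faces. *)
Definition can_build n N (c : {ffun 'I_N -> cube}) : bool :=
  [exists s : {ffun frame n -> 'I_N}, exists q : {ffun frame n -> cube},
    [&& injectiveb s,
        [forall p, same_variety (c (s p)) (q p)] &
        [forall d : face, exists k : color, forall p : frame n,
          on_outer_face d (val p) ==> (face_color (q p) d == k)]]].

Definition always_can_build (n N : nat) : bool :=
  [forall c : {ffun 'I_N -> cube}, can_build n c].

Lemma same_variety_refl (c : cube) : same_variety c c.
Proof.
apply/existsP; exists (1%g, [ffun=> false]).
rewrite /rotation /= odd_perm1 big1 => [|i _]; last by rewrite ffunE.
by apply/forallP => -[i b]; rewrite /move_face /= perm1 ffunE addbF.
Qed.

(* With enough cubes, some coloring occurs #|frame n| times. *)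
Lemma ex_always_can_build (n : nat) : exists N, always_can_build n N.
Proof.
exists (#|{: cube}| * #|{: frame n}|).+1; apply/forallP => c.
have [a le_a] : exists a : cube, #|{: frame n}| <= #|[set i | c i == a]|.
  apply/existsP; apply: contraT; rewrite negb_exists => /forallP lt_a.
  have : #|'I_(#|{: cube}| * #|{: frame n}|).+1| <= #|{: cube}| * #|{: frame n}|.
    rewrite -sum1_card (partition_big c xpredT) //=.
    rewrite -[X in _ <= X]sum_nat_const leq_sum // => a _.
    by rewrite sum1_card -cardsE ltnW // ltnNge lt_a.
  by rewrite card_ord ltnn.
pose s := [ffun p : frame n => enum_val (widen_ord le_a (enum_rank p))].
apply/existsP; exists s; apply/existsP; exists [ffun=> a].
have sa p : c (s p) = a.
  by have := enum_valP (widen_ord le_a (enum_rank p)); rewrite inE ffunE => /eqP.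
apply/and3P; split.
- apply/injectiveP => p p'; rewrite !ffunE => /enum_val_inj [].
  by move/val_inj/enum_rank_inj.
- by apply/forallP => p; rewrite sa ffunE same_variety_refl.
- apply/forallP => d; apply/existsP; exists (face_color a d).
  by apply/forallP => p; rewrite ffunE eqxx implybT.
Qed.

Definition fr (n : nat) : nat := ex_minn (ex_always_can_build n).

(* Main.v *)
Require Import Defs.
From mathcomp Require Import all_boot all_fingroup zify.

(* Let the big cube have variety t.  A cube fits on an edge of it unless the two
   colors of the edge are opposite on the cube, so a cube fails on at most three
   of the twelve edges; and a cube of another variety has either no corner or
   two corners in common with t.  With k = n - 2, all 12 k + 8 cubes have to be
   used, and Hall's theorem reduces this to filling the corners, provided that
   no pair of colors adjacent on t is opposite on more than 11 k cubes, and that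
   no matching of opposite colors, other than that of t, is shared by more than
   9 k cubes.  If one of these bounds is exceeded, the popular matching or pair
   of colors directs us to a heavily represented t.  Otherwise only the corners
   matter.  Seen on t, the cubes of the other varieties are the edges of a graph
   on its 8 corners, and the corners can be filled iff the cubes of variety t
   are at least as many as the components of this graph that are trees.  That
   some t has this property as soon as there are 32 cubes is shown by a search
   over boxes of weights, which are pruned by monotonicity and by the symmetry
   under permutations of the colors. *)

Set Implicit Arguments.
Unset Strict Implicit.
Unset Printing Implicit Defensive.

(** * Varieties, corner keys and fillability *)

(* A coloring is the list of the colors of the faces (0, false), (0, true),
   (1, false), (1, true), (2, false), (2, true).  Varieties 2 j and 2 j + 1 are
   mirror images of each other. *)
Definition reps : seq (seq nat) :=
  [:: [:: 0; 1; 2; 3; 4; 5]; [:: 1; 0; 2; 3; 4; 5]; [:: 0; 1; 2; 4; 3; 5];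
      [:: 1; 0; 2; 4; 3; 5]; [:: 0; 1; 2; 5; 3; 4]; [:: 1; 0; 2; 5; 3; 4];
      [:: 0; 2; 1; 3; 4; 5]; [:: 2; 0; 1; 3; 4; 5]; [:: 0; 2; 1; 4; 3; 5];
      [:: 2; 0; 1; 4; 3; 5]; [:: 0; 2; 1; 5; 3; 4]; [:: 2; 0; 1; 5; 3; 4];
      [:: 0; 3; 1; 2; 4; 5]; [:: 3; 0; 1; 2; 4; 5]; [:: 0; 3; 1; 4; 2; 5];
      [:: 3; 0; 1; 4; 2; 5]; [:: 0; 3; 1; 5; 2; 4]; [:: 3; 0; 1; 5; 2; 4];
      [:: 0; 4; 1; 2; 3; 5]; [:: 4; 0; 1; 2; 3; 5]; [:: 0; 4; 1; 3; 2; 5];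
      [:: 4; 0; 1; 3; 2; 5]; [:: 0; 4; 1; 5; 2; 3]; [:: 4; 0; 1; 5; 2; 3];
      [:: 0; 5; 1; 2; 3; 4]; [:: 5; 0; 1; 2; 3; 4]; [:: 0; 5; 1; 3; 2; 4];
      [:: 5; 0; 1; 3; 2; 4]; [:: 0; 5; 1; 4; 2; 3]; [:: 5; 0; 1; 4; 2; 3]].

Definition rep (v : nat) : seq nat := nth [::] reps v.

(* The colors around a corner, up to cyclic rotation. *)
Definition key (a b c : nat) : seq nat :=
  if (a < b) && (a < c) then [:: a; b; c]
  else if b < c then [:: b; c; a] else [:: c; a; b].

(* The corner with signs x, y, z on the three axes, its faces being listed in
   the cyclic order of positive orientation. *)
Definition corner_key (l : seq nat) (x y z : bool) : seq nat :=
  let a := nth 0 l x in let b := nth 0 l y.+2 in let c := nth 0 l z.+4 in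
  if x (+) y (+) z then key a b c else key b a c.

Definition signs : seq (bool * bool * bool) :=
  [seq (s, z) | s <- [seq (x, y) | x <- [:: false; true], y <- [:: false; true]],
                z <- [:: false; true]].

Definition keys (l : seq nat) : seq (seq nat) :=
  [seq corner_key l s.1.1 s.1.2 s.2 | s <- signs].

(** The eight oriented corner triples determine a coloring up to rotation, so comparing them
    identifies the variety. *)
Definition variety (l : seq nat) : nat :=
  find (fun r => all (mem (keys r)) (keys l)) reps.

Definition recolor (tau l : seq nat) : seq nat := [seq nth 0 tau a | a <- l].

Definition varieties : seq nat := iota 0 30.
Arguments varieties : simpl never.

Lemma mem_varieties v : (v \in varieties) = (v < 30).
Proof. by rewrite mem_iota. Qed.

Lemma size_varieties : size varieties = 30. Proof. by []. Qed.

Lemma varieties_uniq : uniq varieties. Proof. exact: iota_uniq. Qed.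

Lemma nth_varieties v : v < 30 -> nth 0 varieties v = v.
Proof. by move=> lv; rewrite nth_iota. Qed.

(* Hall's condition for filling the corners of a big cube of variety t with
   m v cubes of each variety v. *)
Definition corners_fillable (m : nat -> nat) (t : nat) : Prop :=
  forall S : seq (seq nat), uniq S -> {subset S <= keys (rep t)} ->
    size S <= \sum_(v <- varieties) m v * has (mem (keys (rep v))) S.

Definition fillable (m : nat -> nat) : Prop :=
  exists2 t, t < 30 & corners_fillable m t.

(** * Recoloring *)

Lemma nth_perm_varieties g v : perm_eq g varieties -> v < 30 -> nth 0 g v < 30.
Proof.
move=> gP lv; have := perm_mem gP (nth 0 g v).
by rewrite mem_varieties mem_nth ?(perm_size gP).
Qed.

Lemma sum_perm_varieties g (F : nat -> nat) : perm_eq g varieties ->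
  \sum_(v <- varieties) F (nth 0 g v) = \sum_(v <- varieties) F v.
Proof.
move=> gP; transitivity (\sum_(v <- g) F v); last exact: perm_big.
by rewrite -[in RHS](mkseq_nth 0 g) big_map (perm_size gP).
Qed.

Definition variety_perm (g : seq nat) : Prop :=
  perm_eq g varieties /\
  forall m, fillable (fun v => m (nth 0 g v)) -> fillable m.

Definition compose (p q : seq nat) : seq nat := [seq nth 0 p i | i <- q].

Lemma variety_perm_id : variety_perm varieties.
Proof.
split=> // m [t lt mt]; exists t => // S uS sS; apply: leq_trans (mt S uS sS) _.
by rewrite big_seq [X in _ <= X]big_seq leq_sum // => v; rewrite mem_varieties => lv;
  rewrite nth_varieties.
Qed.

Lemma variety_perm_compose p q :
  variety_perm p -> variety_perm q -> variety_perm (compose p q).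
Proof.
move=> Ap Aq; case: (Ap) (Aq) => pP pF [qP qF].
have sq : size q = 30 by rewrite (perm_size qP).
have sp : size p = 30 by rewrite (perm_size pP).
split.
  rewrite (perm_trans (perm_map _ qP)) // (_ : [seq _ | _ <- _] = p) //.
  by rewrite -[RHS](mkseq_nth 0) sp.
move=> m mF; apply/pF/qF; case: mF => t lt mt; exists t => // S uS sS.
apply: leq_trans (mt S uS sS) _; rewrite big_seq [X in _ <= X]big_seq leq_sum //.
by move=> v; rewrite mem_varieties => lv; rewrite (nth_map 0) ?sq.
Qed.

Definition recolor_key (tau k : seq nat) : seq nat :=
  key (nth 0 tau (nth 0 k 0)) (nth 0 tau (nth 0 k 1)) (nth 0 tau (nth 0 k 2)).

Definition recolor_perm (tau : seq nat) : seq nat :=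
  [seq variety (recolor tau r) | r <- reps].

(** The last test asks [tau] to act as an involution on corner keys, so that [recolor_key tau]
    serves as its own inverse; transpositions pass it. *)
Definition recoloring (tau : seq nat) : bool :=
  let g := recolor_perm tau in
  [&& perm_eq g varieties,
      all (fun v => perm_eq [seq recolor_key tau k | k <- keys (rep v)]
                            (keys (rep (nth 0 g v)))) varieties &
      all (fun v => all (fun k => recolor_key tau (recolor_key tau k) == k)
                        (keys (rep v))) varieties].

(** If [t] works for the permuted weights, its image works for [m]: a set [S] of corners of the
    image is carried back to corners of [t], and the varieties meeting both sets correspond under
    [g]. *)
Lemma recoloring_variety_perm tau :
  recoloring tau -> variety_perm (recolor_perm tau).
Proof.
case/and3P => gP /allP kP /allP iP; set g := recolor_perm tau in gP kP *.
set f := recolor_key tau in kP iP.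
have fK v k : v < 30 -> k \in keys (rep v) -> f (f k) = k.
  by move=> lv kv; apply/eqP; move: k kv; apply/allP/iP; rewrite mem_varieties.
have fv v k : v < 30 -> (k \in keys (rep v)) -> f k \in keys (rep (nth 0 g v)).
  by move=> lv kv; rewrite -(perm_mem (kP v _)) ?mem_varieties // map_f.
have fv' v u k : v < 30 -> u < 30 -> k \in keys (rep u) ->
    f k \in keys (rep (nth 0 g v)) -> k \in keys (rep v).
  move=> lv lu ku; rewrite -(perm_mem (kP v _)) ?mem_varieties //.
  by case/mapP=> k' k'v eqk; rewrite -(fK u k) // eqk (fK v).
split=> // m [t lt mt].
exists (nth 0 g t); first exact: nth_perm_varieties.
move=> S uS sS.
have fS k : k \in S -> (f k \in keys (rep t)) && (f (f k) == k).
  move=> kS; have := sS k kS; rewrite -(perm_mem (kP t _)) ?mem_varieties //.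
  by case/mapP => k' k't ->; rewrite !(fK t k' lt k't) k't eqxx.
have f_inj : {in S &, injective f}.
  by move=> x y /fS/andP[_ /eqP xK] /fS/andP[_ /eqP yK] e; rewrite -xK e yK.
have uf : uniq (map f S) by rewrite map_inj_in_uniq.
have sf : {subset map f S <= keys (rep t)}.
  by move=> _ /mapP[k /fS/andP[kt _] ->].
have := mt _ uf sf; rewrite size_map => /leq_trans; apply.
pose F u := m u * has (mem (keys (rep u))) S.
rewrite -[X in _ <= X](sum_perm_varieties F gP).
rewrite big_seq [X in _ <= X]big_seq leq_sum // => v; rewrite mem_varieties /F => lv.
rewrite leq_mul2l; apply/orP; right; rewrite has_map.
case: (boolP (has (preim f _) S)) => // /hasP[k kS /= kv].
have /andP[kt /eqP kK] := fS k kS.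
rewrite (_ : has _ _ = true) //; apply/hasP; exists k => //=.
by rewrite -[k]kK fv.
Qed.

Definition adjacent_swaps : seq (seq nat) :=
  [seq [seq (if i == k then k.+1 else if i == k.+1 then k else i)
       | i <- iota 0 6] | k <- iota 0 5].

Fixpoint coset_reps (s : seq (seq nat)) (p : seq nat) : seq (seq nat) :=
  p :: if s is g :: s' then coset_reps s' (compose g p) else [::].

(* If s lists generators of the symmetric groups S_(k+1), S_k, ... by adjacent
   transpositions, the products over successive cosets exhaust S_(k+1). *)
Fixpoint coset_products (s : seq (seq nat)) : seq (seq nat) :=
  if s is _ :: s' then
    [seq compose p q | p <- coset_reps s varieties, q <- coset_products s']
  else [:: varieties].

Definition recolorings : seq (seq nat) :=
  coset_products (rev [seq recolor_perm t | t <- adjacent_swaps]).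

Lemma coset_reps_variety_perm s p0 p : {in s, forall g, variety_perm g} ->
  variety_perm p0 -> p \in coset_reps s p0 -> variety_perm p.
Proof.
elim: s p0 => [|g s IHs] p0 sP p0P /=; rewrite inE; first by move/eqP->.
case/predU1P=> [-> //|]; apply: IHs.
  by move=> k ks; apply: sP; rewrite inE ks orbT.
by apply: variety_perm_compose p0P; apply: sP; rewrite mem_head.
Qed.

Lemma coset_products_variety_perm s p : {in s, forall g, variety_perm g} ->
  p \in coset_products s -> variety_perm p.
Proof.
elim: s p => [|g s IHs] p sP.
  by rewrite inE => /eqP ->; exact: variety_perm_id.
case/allpairsP=> -[q r] [qP rP ->]; apply: variety_perm_compose.
  exact: coset_reps_variety_perm sP variety_perm_id qP.
by apply: IHs rP => k ks; apply: sP; rewrite inE ks orbT.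
Qed.

(** Only the five adjacent transpositions are checked by computation; closure under composition
    covers all 720 products. *)
Lemma recolorings_variety_perm g : g \in recolorings -> variety_perm g.
Proof.
apply: coset_products_variety_perm => p; rewrite mem_rev => /mapP[t ts ->].
by apply: recoloring_variety_perm; move: t ts; apply/allP; vm_compute.
Qed.

(** * Filling the corners *)

(* Corners of t are numbered from 0 to 7, as in [keys (rep t)]. *)
Definition common_corners (t v : nat) : seq nat :=
  [seq i <- iota 0 8 | nth [::] (keys (rep t)) i \in keys (rep v)].

(** Evaluated once, because the search consults it constantly. The diagonal is empty: cubes of
    variety [t] fit every corner and are held in reserve, not treated as edges. *)
Definition link_table : seq (seq (seq nat)) := Eval vm_compute in
  [seq [seq if t == v then [::] else common_corners t v | v <- varieties]
  | t <- varieties].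

Definition links (t v : nat) : seq nat := nth [::] (nth [::] link_table t) v.

Lemma linksE t v : t < 30 -> v < 30 ->
  links t v = if t == v then [::] else common_corners t v.
Proof.
move=> lt lv; apply/eqP.
have /allP H : all (fun t => all (fun v => links t v ==
    if t == v then [::] else common_corners t v) varieties) varieties.
  by vm_compute.
by apply: (allP (H t _)); rewrite mem_varieties.
Qed.

(* Regard a cube of another variety as an edge between its two corners on t.
   If st lists the components of this graph that are trees, a set S of corners
   lacks at most one cube for each tree inside S. *)
Definition forest_bound (t : nat) (l : nat -> nat) (st : seq (seq nat)) : Prop :=
  forall S : seq nat, uniq S -> {subset S <= iota 0 8} ->
    size S <= \sum_(v <- varieties) l v * has (mem (links t v)) S
              + count (all (mem S)) st.

(** Two trees touched by the edge merge. If only one is touched, the edge closes a cycle in it or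
    ties it to a component with a cycle, and it is a tree no more. Leaving [st] unchanged is sound
    in any case. *)
Definition add_edge (e : seq nat) (st : seq (seq nat)) : seq (seq nat) :=
  let rest := [seq C <- st | ~~ has (mem e) C] in
  match [seq C <- st | has (mem e) C] with
  | [:: C] => rest
  | [:: C; D] => (C ++ D) :: rest
  | _ => st
  end.

(** The count drops by at most one, and only if the edge touches a tree inside [S], hence [S]
    itself. *)
Lemma add_edge_count e st (S : seq nat) :
  count (all (mem S)) st <= has (mem e) S + count (all (mem S)) (add_edge e st).
Proof.
have split_st : count (all (mem S)) st =
    count (all (mem S)) [seq C <- st | has (mem e) C] +
    count (all (mem S)) [seq C <- st | ~~ has (mem e) C].
  by rewrite -count_cat (seq.permP (permEl (perm_filterC _ _))).
have disj C : ~~ has (mem e) S -> has (mem e) C -> all (mem S) C = false.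
  move=> /hasPn eS /hasP[x xC xe]; apply/negbTE/allPn; exists x => //.
  by apply: contraL xe => /eS.
rewrite /add_edge; move: split_st.
have : all (has (mem e)) [seq C <- st | has (mem e) C] by rewrite filter_all.
case: [seq C <- st | has (mem e) C] => [|C [|D [|? ?]]] /=; rewrite ?andbT.
- by move=> _ _; rewrite leq_addl.
- move=> eC ->; rewrite addn0 leq_add2r.
  by case: (boolP (has (mem e) S)) => [_|/disj/(_ eC)->] //; case: all.
- case/andP=> eC eD ->; rewrite addn0 addnA leq_add2r all_cat.
  case: (boolP (has (mem e) S)) => [_|nS]; first by case: all; case: all.
  by rewrite !disj.
- by move=> _ _; rewrite leq_addl.
Qed.

Lemma forest_bound0 t l : forest_bound t l [seq [:: i] | i <- iota 0 8].
Proof.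
move=> S uS sS; rewrite count_map (eq_count (a2 := mem S)); last first.
  by move=> i /=; rewrite andbT.
rewrite -size_filter; apply: leq_trans (leq_addl _ _).
by apply: uniq_leq_size => // i iS; rewrite mem_filter /= iS sS.
Qed.

Lemma forest_bound_le t l l' st : (forall v, v < 30 -> l v <= l' v) ->
  forest_bound t l st -> forest_bound t l' st.
Proof.
move=> le_l b S uS sS; apply: leq_trans (b S uS sS) _; rewrite leq_add2r.
rewrite big_seq [X in _ <= X]big_seq leq_sum // => v; rewrite mem_varieties => lv.
by rewrite leq_mul2r le_l ?orbT.
Qed.

Lemma forest_bound_add t l l' v st : v < 30 ->
  (forall u, u < 30 -> l u + (u == v) <= l' u) ->
  forest_bound t l st -> forest_bound t l' (add_edge (links t v) st).
Proof.
move=> lv le_l b S uS sS; apply: leq_trans (b S uS sS) _.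
apply: leq_trans (leq_add (leqnn _) (add_edge_count (links t v) st S)) _.
rewrite addnA leq_add2r.
have vV : v \in varieties by rewrite mem_varieties.
rewrite !(bigD1_seq v vV varieties_uniq) addnAC -mulSnr leq_add //.
  by rewrite leq_mul2r -addn1; have := le_l v lv; rewrite eqxx => ->; rewrite orbT.
rewrite big_seq_cond [X in _ <= X]big_seq_cond leq_sum // => u /andP[].
rewrite mem_varieties => lu uv; rewrite leq_mul2r; apply/orP; right.
by have := le_l u lu; rewrite (negbTE uv) addn0.
Qed.

(** Cubes of variety [t] touch every nonempty set of corners, so these [m t] cubes make up a deficit
    bounded by the number of trees. *)
Lemma forest_bound_fillable t l m st : t < 30 ->
  (forall v, v < 30 -> l v <= m v) -> forest_bound t l st -> size st <= m t ->
  corners_fillable m t.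
Proof.
move=> lt le_l b le_st S uS sS; case: (posnP (size S)) => [->//|S_gt0].
have kt : uniq (keys (rep t)).
  have /allP/(_ t) : all (fun t => uniq (keys (rep t))) varieties by vm_compute.
  by apply; rewrite mem_varieties.
pose S' := [seq index k (keys (rep t)) | k <- S].
have sz : size (keys (rep t)) = 8 by [].
have uS' : uniq S'.
  rewrite map_inj_in_uniq // => x y /sS xt /sS yt e.
  by rewrite -(nth_index [::] xt) e nth_index.
have sS' : {subset S' <= iota 0 8}.
  move=> _ /mapP[k /sS kt' ->]; rewrite mem_iota.
  by have : index k (keys (rep t)) < size (keys (rep t)) by rewrite index_mem.
have := b S' uS' sS'; rewrite size_map => /leq_trans; apply.
rewrite addnC.
(* Split off the term of [t]: it is zero in the forest bound, whose links are empty there, and [m t]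
   in Hall's condition. *)
have tV : t \in varieties by rewrite mem_varieties.
rewrite !(bigD1_seq t tV varieties_uniq) linksE // eqxx.
rewrite [has (mem [::]) _](_ : _ = false) ?muln0 ?add0n; last first.
  by apply/hasP => -[].
apply: leq_add.
  apply: leq_trans (count_size _ _) (leq_trans le_st _).
  rewrite (_ : has _ _ = true) ?muln1 //; case: S S_gt0 sS {uS S' uS' sS'} => //.
  by move=> k S _ sS /=; rewrite sS ?mem_head.
rewrite big_seq_cond [X in _ <= X]big_seq_cond leq_sum // => v /andP[].
rewrite mem_varieties => lv vt; rewrite linksE // eq_sym (negbTE vt).
rewrite leq_mul ?le_l // has_map.
case: (boolP (has (preim _ _) S)) => // /hasP[k kS /=].
rewrite mem_filter nth_index ?sS // => /andP[kv _].
by rewrite (_ : has _ _ = true) //; apply/hasP; exists k.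
Qed.

(** * Exhaustive search over boxes of weights *)

Definition of_fun (T : Type) (f : nat -> T) : seq T := [seq f v | v <- varieties].

Lemma nth_of_fun T (x0 : T) f v : v < 30 -> nth x0 (of_fun f) v = f v.
Proof. by move=> lv; rewrite (nth_map 0) ?size_varieties // nth_varieties. Qed.

Definition settled (lo : seq nat) (ts : seq (seq (seq nat))) : bool :=
  has (fun t => size (nth [::] ts t) <= nth 0 lo t) varieties.

(** A hot target is one cube short. If one more cube of variety [v] completes a hot target, only the
    weight [nth 0 lo v] remains to be examined; otherwise [v] is itself a good target once its
    weight reaches its number of trees. *)
Definition cut (lo hi : seq nat) (ts : seq (seq (seq nat))) : seq nat :=
  let hot := [seq t <- varieties | size (nth [::] ts t) == (nth 0 lo t).+1] in
  of_fun (fun v =>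
    if has (fun t => size (add_edge (links t v) (nth [::] ts t)) <= nth 0 lo t)
           hot then nth 0 lo v
    else minn (nth 0 hi v) (size (nth [::] ts v)).-1).

Definition fixes (s g : seq nat) : bool :=
  all (fun v => nth 0 s (nth 0 g v) == nth 0 s v) varieties.

Definition widest (lo hi : seq nat) : nat :=
  foldl (fun u v => if nth 0 hi u - nth 0 lo u < nth 0 hi v - nth 0 lo v
                    then v else u) 0 varieties.

(** Rounding the midpoint [c] up makes both halves proper whenever the interval has more than one
    value. Only symmetries fixing both bounds survive in [G'], so they preserve the box being
    split. *)
Definition branch (rec : seq (seq nat) -> seq nat -> seq nat ->
      seq (seq (seq nat)) -> bool)
    (G : seq (seq nat)) (lo hi : seq nat) (ts : seq (seq (seq nat))) : bool :=
  let G' := [seq g <- G | fixes lo g && fixes hi g] in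
  let v := widest lo hi in
  let c := nth 0 lo v + uphalf (nth 0 hi v - nth 0 lo v) in
  let orbit := [seq nth 0 g v | g <- G'] in
  let raise ts := of_fun (fun t => add_edge (links t v) (nth [::] ts t)) in
  [&& v < 30,
      rec G' (of_fun (fun u => if u == v then c else nth 0 lo u)) hi
          (iter (c - nth 0 lo v) raise ts) &
      rec G' lo (of_fun (fun u => if u \in orbit
                         then minn (nth 0 hi u) c.-1 else nth 0 hi u)) ts].

(* Shows that all weights m with lo <= m <= hi and total at least 32 are
   fillable, ts being the tree components for the lower bounds lo.  The box is
   split at the weight of variety v; by symmetry under the recolorings that
   preserve the box, the case where v is heavy covers its whole orbit. *)
Fixpoint search (fuel : nat) (G : seq (seq nat)) (lo hi : seq nat)
    (ts : seq (seq (seq nat))) : bool :=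
  if fuel is fuel'.+1 then
    if settled lo ts then true else
    let hi' := cut lo hi ts in
    if sumn hi' < 32 then true else branch (search fuel') G lo hi' ts
  else false.

Lemma cut_sound lo hi ts m :
  (forall t, t < 30 -> forest_bound t (nth 0 lo) (nth [::] ts t)) ->
  (forall v, v < 30 -> nth 0 lo v <= m v <= nth 0 hi v) ->
  fillable m \/ forall v, v < 30 -> nth 0 lo v <= m v <= nth 0 (cut lo hi ts) v.
Proof.
move=> tsP bm.
case: (boolP (all (fun v => m v <= nth 0 (cut lo hi ts) v) varieties)).
  move/allP=> le_m; right=> v lv; rewrite le_m ?mem_varieties // andbT.
  by case/andP: (bm v lv).
case/allPn=> v; rewrite mem_varieties => lv; rewrite nth_of_fun // -ltnNge => lt_v.
left; move: lt_v; case: hasP => [[t] | _ lt_v].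
  rewrite mem_filter mem_varieties => /andP[_ lt] le_t lt_v; exists t => //.
  apply: (forest_bound_fillable (l := fun u => nth 0 lo u + (u == v)) lt).
  - move=> u lu; have [-> | _] := eqVneq u v; first by rewrite addn1.
    by rewrite addn0; case/andP: (bm u lu).
  - by apply: (forest_bound_add lv _ (tsP t lt)).
  - by apply: leq_trans le_t _; case/andP: (bm t lt).
exists v => //; apply: (forest_bound_fillable lv _ (tsP v lv)) => [u lu|].
  by case/andP: (bm u lu).
by case/andP: (bm v lv) => _; lia.
Qed.

Lemma sum_le_sumn m s : size s = 30 ->
  (forall v, v < 30 -> m v <= nth 0 s v) -> \sum_(v <- varieties) m v <= sumn s.
Proof.
move=> sz le_m; rewrite sumnE [X in _ <= X](big_nth 0) sz /index_iota subn0.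
by rewrite big_seq [X in _ <= X]big_seq leq_sum // => v; rewrite mem_varieties => /le_m.
Qed.

Definition search_spec (rec : seq (seq nat) -> seq nat -> seq nat ->
    seq (seq (seq nat)) -> bool) : Prop := forall G lo hi ts m,
  {in G, forall g, variety_perm g} ->
  (forall t, t < 30 -> forest_bound t (nth 0 lo) (nth [::] ts t)) ->
  rec G lo hi ts ->
  (forall v, v < 30 -> nth 0 lo v <= m v <= nth 0 hi v) ->
  32 <= \sum_(v <- varieties) m v -> fillable m.

(** If some variety of the orbit of [v] has weight at least [c], a symmetry of the box moves it to
    [v] and the heavy half applies; otherwise the whole orbit is light. *)
Lemma branch_sound rec : search_spec rec -> search_spec (branch rec).
Proof.
move=> IH G lo hi ts m GP tsP; rewrite /branch.
set G' := filter _ G; set v := widest lo hi; set c := _ + uphalf _.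
set orbit := map _ _.
case/and3P => lv heavy light bm sum_m.
have G'P g : g \in G' -> [/\ fixes lo g, fixes hi g & variety_perm g].
  by rewrite mem_filter => /andP[/andP[-> ->] /GP].
have G'V : {in G', forall g, variety_perm g} by move=> g /G'P[].
have le_c : nth 0 lo v <= c by rewrite leq_addr.
case: (boolP (has (fun g => c <= m (nth 0 g v)) G')) => [|/hasPn lightP]; last first.
  apply: (IH _ _ _ _ _ G'V tsP light) => // u lu; have /andP[lo_u hi_u] := bm u lu.
  rewrite lo_u nth_of_fun //; case: ifP => // /mapP[g gG' eu].
  by have := lightP g gG'; rewrite -eu -ltnNge; lia.
case/hasP=> g gG' heavy_g; have [/allP flo /allP fhi [gP gF]] := G'P g gG'.
apply: gF; apply: (IH _ _ _ _ _ G'V _ heavy) => [t lt | u lu |].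
(* Each round of [raise] accounts for one more cube of variety [v]. *)
- rewrite -(subnKC le_c); move: (c - _) => k; rewrite addKn.
  elim: k => [|k IHk].
    apply: forest_bound_le (tsP t lt) => u lu; rewrite nth_of_fun //.
    by case: eqP => [->|//]; rewrite addn0.
  rewrite iterS nth_of_fun //; apply: (forest_bound_add lv _ IHk) => u lu.
  by rewrite !nth_of_fun //; case: eqP => _; rewrite ?addn0 // addnS addn1.
- have lg : nth 0 g u < 30 := nth_perm_varieties gP lu.
  have /andP[lo_u hi_u] := bm _ lg; rewrite -(eqP (fhi u _)) ?mem_varieties // hi_u.
  rewrite nth_of_fun //; case: eqP => [->|_]; first by rewrite heavy_g.
  by rewrite -(eqP (flo u _)) ?mem_varieties // lo_u.
- by rewrite sum_perm_varieties.
Qed.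

Lemma searchS fuel G lo hi ts :
  search fuel.+1 G lo hi ts =
    if settled lo ts then true else if sumn (cut lo hi ts) < 32 then true
    else branch (search fuel) G lo (cut lo hi ts) ts.
Proof. by []. Qed.

Lemma search_sound fuel : search_spec (search fuel).
Proof.
elim: fuel => // fuel IH G lo hi ts m GP tsP.
rewrite searchS.
case: ifP => [/hasP[t tV le_t] _ | _ rest] bm sum_m.
  have lt : t < 30 by rewrite -mem_varieties.
  exists t => //.
  apply: (forest_bound_fillable lt _ (tsP t lt)) => [v lv|].
    by case/andP: (bm v lv).
  by apply: leq_trans le_t _; case/andP: (bm t lt).
have [//|{}bm] := cut_sound tsP bm.
have sz : size (cut lo hi ts) = 30 by rewrite size_map size_varieties.
move: (cut lo hi ts) bm sz rest => {}hi bm sz; case: ifP => [lt32 _ | _]; last first.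
  by move/(branch_sound IH GP tsP); apply.
move: sum_m; rewrite leqNgt (leq_ltn_trans _ lt32) //.
by apply: sum_le_sumn => // v /bm/andP[].
Qed.

(** Weights from 8 on are left to [heavy_fillable], hence the upper bound 7. With lower bounds 0 the
    trees are the eight isolated corners; 40 bounds the depth of the recursion. *)
Lemma search_true :
  search 40 recolorings (nseq 30 0) (nseq 30 7)
         (nseq 30 [seq [:: i] | i <- iota 0 8]).
Proof. vm_cast_no_check (erefl true). Qed.

(* The components for the cubes listed in es, with repetitions. *)
Definition trees (t : nat) (es : seq nat) : seq (seq nat) :=
  foldr (fun v => add_edge (links t v)) [seq [:: i] | i <- iota 0 8] es.

Lemma trees_fillable t es m : t < 30 -> all (fun v => v < 30) es ->
  (forall v, v < 30 -> count_mem v es <= m v) -> size (trees t es) <= m t ->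
  corners_fillable m t.
Proof.
move=> lt les le_m; apply: forest_bound_fillable le_m _ => //.
elim: es les => [|v es IHes] /= => [_|/andP[lv les]]; first exact: forest_bound0.
by apply: (forest_bound_add lv _ (IHes les)) => u _; rewrite addnC eq_sym.
Qed.

Lemma heavy_fillable t m : t < 30 -> 8 <= m t -> corners_fillable m t.
Proof. by move=> lt le8; apply: (@trees_fillable t [::]). Qed.

Lemma weights_fillable m : 32 <= \sum_(v <- varieties) m v -> fillable m.
Proof.
move=> le32; case: (boolP (has (fun v => 8 <= m v) varieties)).
  case/hasP=> v; rewrite mem_varieties => lv le8; exists v => //.
  exact: heavy_fillable.
move/hasPn=> lt8; apply: (search_sound _ _ search_true) => // [g|t lt|v lv].
- exact: recolorings_variety_perm.
- by rewrite nth_nseq lt; apply: forest_bound0.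
- by rewrite !nth_nseq lv /= -ltnS ltnNge; apply: lt8; rewrite mem_varieties.
Qed.

(** * Opposite colors *)

(** Opposite faces occupy the list positions 2 j and 2 j + 1. *)
Definition opp_color (l : seq nat) (a : nat) : nat :=
  let i := index a l in nth 0 l (if odd i then i.-1 else i.+1).

Definition opp_colors (l : seq nat) : seq nat := [seq opp_color l a | a <- iota 0 6].

Lemma opp_colorE l a : a < 6 -> opp_color l a = nth 0 (opp_colors l) a.
Proof. by move=> la; rewrite (nth_map 0) ?size_iota // nth_iota. Qed.

Definition weight (m : nat -> nat) (s : seq nat) : nat := \sum_(v <- s) m v.

Definition pencil (a b : nat) : seq nat :=
  [seq v <- varieties | opp_color (rep v) a == b].

Definition mates (t : nat) : seq nat :=
  [seq v <- varieties | opp_colors (rep v) == opp_colors (rep t)].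

Lemma weight_le m s : uniq s -> {subset s <= varieties} ->
  weight m s <= weight m varieties.
Proof.
move=> us ss; have sP : perm_eq s [seq v <- varieties | v \in s].
  apply: uniq_perm; rewrite ?filter_uniq ?varieties_uniq // => v.
  by rewrite mem_filter; case: (boolP (v \in s)) => // /ss ->.
rewrite /weight (perm_big _ sP) big_filter [X in _ <= X](bigID (mem s)).
exact: leq_addr.
Qed.

Lemma pencil_nil a b : a < 6 -> ~~ ((a != b) && (b < 6)) -> pencil a b = [::].
Proof.
move=> la nb; apply/eqP; rewrite -(negbK (_ == _)) -has_filter; apply/hasPn => v.
rewrite mem_varieties => lv; apply: contra nb => /eqP <-.
have /allP/(_ v) : all (fun v => all (fun a => (a != opp_color (rep v) a)
  && (opp_color (rep v) a < 6)) (iota 0 6)) varieties by vm_compute.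
by rewrite mem_varieties lv => /(_ isT)/allP/(_ a); rewrite mem_iota la; exact.
Qed.

(* With k = n - 2, Hall's condition for a frame of variety t: the cubes that
   fit on none of f given edges number at most (12 - f) k.  Such cubes exist
   only for f <= 3, and for f >= 2 they have the same opposite colors. *)
Definition good_target (k : nat) (m : nat -> nat) (t : nat) : Prop :=
  [/\ corners_fillable m t,
      forall a b, a < 6 -> opp_color (rep t) a != b ->
        weight m (pencil a b) <= 11 * k &
      forall v, v < 30 -> opp_colors (rep v) != opp_colors (rep t) ->
        weight m (mates v) <= 9 * k].

Lemma mates_spec v : v < 30 -> exists t u,
  [/\ t < 30, u < 30, mates v = [:: t; u], mates t = [:: t; u] &
      mates u = [:: t; u]].
Proof.
move=> lv.
have /allP/(_ v) : all (fun v => if mates v is [:: t; u] then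
  [&& t < 30, u < 30, mates t == [:: t; u] & mates u == [:: t; u]] else false)
  varieties by vm_compute.
rewrite mem_varieties lv => /(_ isT).
case: (mates v) => [|t [|u []]] // /and4P[lt lu /eqP mt /eqP mu].
exists t, u; exact: (And5 lt lu erefl mt mu).
Qed.

(** More than 9 k >= 18 cubes in a mirror pair give one of its varieties at least 8, enough for all
    corners. At most 3 k + 7 cubes lie outside the pair, which is within both remaining bounds. *)
Lemma heavy_mates k m v : 1 < k -> weight m varieties = 12 * k + 8 ->
  v < 30 -> 9 * k < weight m (mates v) -> exists2 t, t < 30 & good_target k m t.
Proof.
move=> k_gt1 wm lv heavy.
have [t [u [lt lu mv mt mu]]] := mates_spec lv.
have [x [lx ex mx]] : exists x, [/\ x < 30, mates x = mates v & 8 <= m x].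
  move: heavy; rewrite mv /weight !big_cons big_nil => heavy.
  have [le_ut|lt_tu] := leqP (m u) (m t).
    by exists t; rewrite mt; split=> //; lia.
  by exists u; rewrite mu; split=> //; lia.
have small s : uniq s -> {subset s <= varieties} ->
    (forall w, w \in s -> opp_colors (rep w) != opp_colors (rep x)) ->
    weight m s <= 3 * k + 7.
  move=> us ss sx.
  have : weight m (s ++ mates x) <= weight m varieties.
    apply: weight_le.
      rewrite cat_uniq us filter_uniq ?varieties_uniq // andbT.
      apply/hasPn => w; rewrite mem_filter => /andP[/eqP ew _].
      by apply/negP => /sx; rewrite ew eqxx.
    move=> w; rewrite mem_cat => /orP[/ss //|].
    by rewrite mem_filter => /andP[].
  by rewrite wm /weight big_cat /= -!/(weight _ _) ex; lia.
have sub_filter p : {subset [seq w <- varieties | p w] <= varieties}.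
  by move=> w; rewrite mem_filter => /andP[].
exists x => //; split; first exact: heavy_fillable.
- move=> a b la ab; apply: (leq_trans (small _ _ (sub_filter _) _)); last by lia.
    by rewrite filter_uniq ?varieties_uniq.
  move=> w; rewrite mem_filter => /andP[/eqP ew _]; apply: contra ab => /eqP e.
  by rewrite opp_colorE // -e -opp_colorE // ew.
- move=> w lw wx; apply: (leq_trans (small _ _ (sub_filter _) _)); last by lia.
    by rewrite filter_uniq ?varieties_uniq.
  by move=> y; rewrite mem_filter => /andP[/eqP -> _].
Qed.

(* The varieties of a pencil, in mirror pairs, with t the one chosen as the
   target: a cube of another pair covers two corners of t, and these are
   different for the two other pairs. *)
Definition pencil_target (t t' u u' v v' : nat) : bool :=
  [&& all (fun x => x < 30) [:: t; t'; u; u'; v; v'],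
      all (fun x => size (trees t [:: x; x]) <= 6) [:: u; u'; v; v'],
      all (fun x => all (fun y => size (trees t [:: x; x; y; y]) <= 4)
                        [:: v; v']) [:: u; u'],
      all (fun x => all (fun y => x != y) [:: v; v']) [:: u; u'] &
      all (fun a => all (fun b => (opp_color (rep t) a == b)
        || uniq (pencil a b ++ [:: t; t'; u; u'])
        || uniq (pencil a b ++ [:: t; t'; v; v'])) (iota 0 6)) (iota 0 6)].

(** The pencil holds at least 23 cubes and the pair of [t] is its heaviest. Thus [m t] is at least
    4, and when it is below 8 the other pairs supply the edges that reduce the number of trees. *)
Lemma pencil_target_good k m t t' u u' v v' : 1 < k ->
  weight m varieties = 12 * k + 8 -> pencil_target t t' u u' v v' ->
  (forall x, x < 30 -> weight m (mates x) <= 9 * k) ->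
  11 * k < m t + m t' + (m u + m u') + (m v + m v') ->
  m t' <= m t -> m u + m u' <= m t + m t' -> m v + m v' <= m t + m t' ->
  good_target k m t.
Proof.
move=> k_gt1 wm /and5P[lts /allP t1 /allP t2 /allP d2 /allP pP] mP heavy tt' ut vt.
have /and5P[lt lt' lu lu' /and3P[lv lv' _]] := lts.
split; last by move=> x lx _; exact: mP.
- have one x : x \in [:: u; u'; v; v'] -> 2 <= m x -> 6 <= m t ->
      corners_fillable m t.
    move=> xin mx mt; have lx : x < 30.
      by move: xin; rewrite !inE => /or4P[] /eqP ->.
    apply: (@trees_fillable t [:: x; x]) => //=; first by rewrite lx.
      by move=> y _; case: eqP => [<-|].
    exact: leq_trans (t1 x xin) mt.
  have two x y : x \in [:: u; u'] -> y \in [:: v; v'] -> 2 <= m x -> 2 <= m y ->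
      4 <= m t -> corners_fillable m t.
    move=> xin yin mx my mt; have lx : x < 30.
      by move: xin; rewrite !inE => /orP[] /eqP ->.
    have ly : y < 30 by move: yin; rewrite !inE => /orP[] /eqP ->.
    apply: (@trees_fillable t [:: x; x; y; y]) => //=; first by rewrite lx ly.
      move=> z _; have xy : x != y by apply: (allP (d2 x xin)).
      have [<-|_] := eqVneq x z; last by case: eqP => [<-|].
      by rewrite eq_sym (negbTE xy).
    exact: leq_trans (allP (t2 x xin) y yin) mt.
  have [le8|lt8] := leqP 8 (m t); first exact: heavy_fillable.
  (* Here the pair of [t] has at most 14 cubes, so at least 9 lie in the other four varieties and
     one of these occurs twice; its double edge leaves six trees. *)
  have [le6|lt6] := leqP 6 (m t).
    have [|mu] := leqP 2 (m u).
      by move/one; apply; rewrite // !inE eqxx ?orbT.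
    have [|mu'] := leqP 2 (m u').
      by move/one; apply; rewrite // !inE eqxx ?orbT.
    have [|mv] := leqP 2 (m v).
      by move/one; apply; rewrite // !inE eqxx ?orbT.
    have [|mv'] := leqP 2 (m v').
      by move/one; apply; rewrite // !inE eqxx ?orbT.
    lia.
  (* Now each pair has at most 10 cubes, so each has at least 3 and contains a variety occurring
     twice; two double edges leave four trees. *)
  have [x xin mx] : exists2 x, x \in [:: u; u'] & 2 <= m x.
    have [mu|mu] := leqP 2 (m u); first by exists u; rewrite // mem_head.
    by exists u'; rewrite ?inE ?eqxx ?orbT //; lia.
  have [y yin my] : exists2 y, y \in [:: v; v'] & 2 <= m y.
    have [mv|mv] := leqP 2 (m v); first by exists v; rewrite // mem_head.
    by exists v'; rewrite ?inE ?eqxx ?orbT //; lia.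
  by apply: two xin yin mx my _; lia.
(* Another pencil misses the pair of [t] and one of the other two. These two pairs hold more than
   half of 11 k cubes, hence at least k + 8. *)
- move=> a b la ab; have [lb|ge6] := ltnP b 6; last first.
    by rewrite pencil_nil // ?/weight ?big_nil // ltnNge ge6 andbF.
  have := pP a; rewrite mem_iota la => /(_ isT)/allP/(_ b).
  rewrite mem_iota lb (negbTE ab) orFb => /(_ isT).
  have le_s s : uniq (pencil a b ++ s) -> all (fun x => x < 30) s ->
      weight m (pencil a b) + weight m s <= 12 * k + 8.
    move=> us /allP sP; rewrite /weight -big_cat -wm; apply: weight_le us _ => x.
    rewrite mem_cat => /orP[|/sP]; last by rewrite mem_varieties.
    by rewrite mem_filter => /andP[].
  have uP : all (fun x => x < 30) [:: t; t'; u; u'] by rewrite /= lt lt' lu lu'.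
  have vP : all (fun x => x < 30) [:: t; t'; v; v'] by rewrite /= lt lt' lv lv'.
  by case/orP=> /le_s; [move/(_ uP) | move/(_ vP)];
    rewrite [weight m [:: _, _ & _]]/weight !big_cons big_nil;
    move: (weight _ _) => w; lia.
Qed.

Lemma pencil_targets a b : a < 6 -> b < 6 -> a != b ->
  exists t t' u u' v v',
  [/\ pencil a b = [:: t; t'; u; u'; v; v'],
      pencil_target t t' u u' v v' && pencil_target t' t u u' v v',
      pencil_target u u' t t' v v' && pencil_target u' u t t' v v' &
      pencil_target v v' t t' u u' && pencil_target v' v t t' u u'].
Proof.
move=> la lb ab.
have /allP/(_ a) : all (fun a => all (fun b => (a == b) ||
    if pencil a b is [:: t; t'; u; u'; v; v'] then
    [&& pencil_target t t' u u' v v' && pencil_target t' t u u' v v',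
        pencil_target u u' t t' v v' && pencil_target u' u t t' v v' &
        pencil_target v v' t t' u u' && pencil_target v' v t t' u u'] else false)
  (iota 0 6)) (iota 0 6) by vm_compute.
rewrite mem_iota la => /(_ isT)/allP/(_ b); rewrite mem_iota lb => /(_ isT).
rewrite (negbTE ab) orFb.
case: (pencil a b) => [|t [|t' [|u [|u' [|v [|v' []]]]]]] // /and3P[p1 p2 p3].
by exists t, t', u, u', v, v'; exact: And4 erefl p1 p2 p3.
Qed.

(** The target is the more frequent variety of the heaviest of the three mirror pairs. *)
Lemma heavy_pencil k m a b : 1 < k -> weight m varieties = 12 * k + 8 ->
  (forall x, x < 30 -> weight m (mates x) <= 9 * k) ->
  a < 6 -> b < 6 -> a != b -> 11 * k < weight m (pencil a b) ->
  exists2 t, t < 30 & good_target k m t.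
Proof.
move=> k_gt1 wm mP la lb ab.
have [t [t' [u [u' [v [v' [-> ]]]]]]] := pencil_targets la lb ab.
case/andP=> pt pt' /andP[pu pu'] /andP[pv pv'].
rewrite /weight !big_cons big_nil => heavy.
have target x x' y y' z z' : pencil_target x x' y y' z z' ->
    11 * k < m x + m x' + (m y + m y') + (m z + m z') ->
    m x' <= m x -> m y + m y' <= m x + m x' -> m z + m z' <= m x + m x' ->
    exists2 t, t < 30 & good_target k m t.
  move=> px hx xx' yx zx; exists x; first by case/and5P: px => /andP[].
  exact: (pencil_target_good k_gt1 wm px mP).
have [ut|tu] := leqP (m u + m u') (m t + m t').
  have [vt|tv] := leqP (m v + m v') (m t + m t').
    by have [le|lt] := leqP (m t') (m t);
      [apply: target pt _ _ _ _ | apply: target pt' _ _ _ _]; lia.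
  by have [le|lt] := leqP (m v') (m v);
    [apply: target pv _ _ _ _ | apply: target pv' _ _ _ _]; lia.
have [vu|uv] := leqP (m v + m v') (m u + m u').
  by have [le|lt] := leqP (m u') (m u);
    [apply: target pu _ _ _ _ | apply: target pu' _ _ _ _]; lia.
by have [le|lt] := leqP (m v') (m v);
  [apply: target pv _ _ _ _ | apply: target pv' _ _ _ _]; lia.
Qed.

Lemma exists_good_target k m : 1 < k -> weight m varieties = 12 * k + 8 ->
  exists2 t, t < 30 & good_target k m t.
Proof.
move=> k_gt1 wm.
case: (boolP (has (fun v => 9 * k < weight m (mates v)) varieties)).
  by case/hasP=> v; rewrite mem_varieties => lv; exact: heavy_mates.
move=> /hasPn mP; have {}mP x : x < 30 -> weight m (mates x) <= 9 * k.
  by move=> lx; rewrite leqNgt mP ?mem_varieties.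
case: (boolP (has (fun a => has (fun b =>
    (a != b) && (11 * k < weight m (pencil a b))) (iota 0 6)) (iota 0 6))).
  case/hasP=> a; rewrite mem_iota => la /hasP[b]; rewrite mem_iota => lb /andP[ab].
  exact: heavy_pencil.
(* As k >= 2, there are 12 k + 8 >= 32 cubes, the threshold of the search. *)
move=> /hasPn pP; have [|t lt mt] := @weights_fillable m.
  by rewrite -/(weight m varieties) wm; lia.
exists t => //; split=> // [a b la _ | v lv _]; last exact: mP.
have [/andP[ab lb] | nb] := boolP ((a != b) && (b < 6)); last first.
  by rewrite pencil_nil // /weight big_nil.
have := pP a; rewrite mem_iota la => /(_ isT)/hasPn/(_ b).
by rewrite mem_iota ab -leqNgt; apply.
Qed.

(** * Turning cubes *)

Definition axis0 : 'I_3 := @Ordinal 3 0 isT.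
Definition axis1 : 'I_3 := @Ordinal 3 1 isT.
Definition axis2 : 'I_3 := @Ordinal 3 2 isT.

Lemma axisP (P : 'I_3 -> Prop) : P axis0 -> P axis1 -> P axis2 -> forall i, P i.
Proof.
move=> P0 P1 P2 [[|[|[|//]]] lt]; [move: P0 | move: P1 | move: P2];
  by congr P; apply: val_inj.
Qed.

Lemma move_face_inj r : injective (move_face r).
Proof.
by move=> [i b] [j b'] [/perm_inj/= -> /addIb ->].
Qed.

Lemma face_color_onto (x : cube) a : exists f, face_color x f = a.
Proof. by have /forallP/(_ a)/existsP[f /eqP] := valP x; exists f. Qed.

Lemma turn_cube (x : cube) r : rotation r -> exists y : cube,
  same_variety x y /\ forall f, face_color y (move_face r f) = face_color x f.
Proof.
move=> rP; pose g := [ffun f => face_color x (invF (@move_face_inj r) f)].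
have gE f : g (move_face r f) = face_color x f by rewrite ffunE invF_f.
have gP : [forall a : color, exists f : face, g f == a].
  apply/forallP=> a; have [f fa] := face_color_onto x a.
  by apply/existsP; exists (move_face r f); rewrite gE fa.
exists (exist _ g gP); split=> //; apply/existsP; exists r; rewrite rP.
by apply/forallP => f; rewrite /face_color gE.
Qed.

(** Equality of the two parities says that the signed permutation carrying the first flag of faces
    to the second has determinant 1. *)
Lemma place_cube (x : cube) (p q : 'S_3) (e d : 'I_3 -> bool) :
  odd_perm p (+) \big[addb/false]_i e i = odd_perm q (+) \big[addb/false]_i d i ->
  exists y : cube, same_variety x y /\
    forall i, face_color y (q i, d i) = face_color x (p i, e i).
Proof.
move=> eq_par.
pose r : symmetry :=
  ((p^-1 * q)%g, [ffun j => e ((p^-1)%g j) (+) d ((p^-1)%g j)]).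
have rP : rotation r.
  rewrite /rotation /r /= odd_permM odd_permV.
  rewrite (reindex_inj (@perm_inj _ p)) /=.
  under eq_bigr => i _ do rewrite ffunE permK.
  by rewrite big_split /= addbACA eq_par addbb.
have [y [xy yP]] := turn_cube x rP; exists y; split=> // i.
by rewrite -yP /move_face /r /= ffunE permM !permK addbA addbb addFb.
Qed.

Lemma exists_perm3 (i j : 'I_3) : i != j ->
  exists p : 'S_3, p axis0 = i /\ p axis1 = j.
Proof.
move=> ij; set u := tperm axis0 i axis1.
have ui : u != i by rewrite -(inj_eq (@perm_inj _ (tperm axis0 i))) tpermK tpermR.
exists (tperm axis0 i * tperm u j)%g; rewrite !permM tpermL -/u tpermL.
by rewrite tpermD // eq_sym.
Qed.

Lemma big_axes (F : 'I_3 -> bool) :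
  \big[addb/false]_i F i = F axis0 (+) F axis1 (+) F axis2.
Proof.
rewrite !big_ord_recl big_ord0 addbF addbA.
by congr (F _ (+) F _ (+) F _); apply: val_inj.
Qed.

Lemma place_edge (x : cube) (f f' d d' : face) : f.1 != f'.1 -> d.1 != d'.1 ->
  exists y : cube, [/\ same_variety x y, face_color y d = face_color x f &
    face_color y d' = face_color x f'].
Proof.
move=> ff' dd'; have [p [p0 p1]] := exists_perm3 ff'.
have [q [q0 q1]] := exists_perm3 dd'.
pose sg b b' b'' (i : 'I_3) : bool :=
  if i == axis0 then b else if i == axis1 then b' else b''.
(* The sign on the third axis is unconstrained and is chosen to make the motion a rotation. *)
pose z := odd_perm p (+) odd_perm q (+) f.2 (+) f'.2 (+) d.2 (+) d'.2.
have [|y [xy yP]] := @place_cube x p q (sg f.2 f'.2 false) (sg d.2 d'.2 z).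
  rewrite !big_axes /sg /= /z; move: (odd_perm p) (odd_perm q) f.2 f'.2 d.2 d'.2.
  by do 6!case.
exists y; split=> //.
  by have := yP axis0; rewrite p0 q0 /sg /= -!surjective_pairing.
by have := yP axis1; rewrite p1 q1 /sg /= -!surjective_pairing.
Qed.

Lemma key_rot a b c a' b' c' : key a b c = key a' b' c' ->
  [\/ [/\ a = a', b = b' & c = c'], [/\ a = b', b = c' & c = a'] |
      [/\ a = c', b = a' & c = b']].
Proof.
rewrite /key; case: ifP => _; [|case: ifP => _]; (case: ifP => _; [|case: ifP => _]).
all: by move=> [-> -> ->]; constructor.
Qed.

(** * Cubes as lists of colors *)

Definition color_list (x : cube) : seq nat :=
  [seq nat_of_ord (face_color x f) | f <-
    [:: (axis0, false); (axis0, true); (axis1, false); (axis1, true);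
        (axis2, false); (axis2, true)]].

Lemma nth_color_list x (f : face) :
  nth 0 (color_list x) (f.1.*2 + f.2) = face_color x f.
Proof.
by case: f => i b; move: i; apply: axisP; case: b.
Qed.

(** A surjection from six faces onto six colors repeats none. *)
Lemma face_color_inj (x : cube) : injective (face_color x).
Proof.
apply/injectiveP; rewrite /injectiveb /dinjectiveb.
apply: (@leq_size_uniq _ (enum 'I_6)); rewrite ?enum_uniq //.
  move=> a _; have [f <-] := face_color_onto x a.
  by apply: map_f; rewrite mem_enum.
by rewrite size_map -!cardE card_prod card_bool !card_ord.
Qed.

Lemma color_list_perm x : perm_eq (color_list x) (iota 0 6).
Proof.
have u : uniq (color_list x).
  by rewrite map_inj_uniq // => f g /val_inj/face_color_inj.
have sub : {subset color_list x <= iota 0 6}.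
  by move=> a /mapP[f _ ->]; rewrite mem_iota /= ltn_ord.
by have [] := uniq_min_size u sub (leqnn 6) => _; apply: uniq_perm.
Qed.

Lemma opp_color_face x (f : face) :
  opp_color (color_list x) (face_color x f) = face_color x (f.1, ~~ f.2).
Proof.
have u : uniq (color_list x) by rewrite (perm_uniq (color_list_perm x)) iota_uniq.
rewrite /opp_color -nth_color_list index_uniq //; last first.
  by case: f => i b; move: i; apply: axisP; case: b.
rewrite oddD odd_double oddb -nth_color_list; congr nth.
by case: f => i [] /=; rewrite ?addn0 ?addn1.
Qed.

(** A finite check over the 720 orderings of the colors. *)
Lemma variety_spec x (v := variety (color_list x)) :
  [/\ v < 30, perm_eq (keys (color_list x)) (keys (rep v)) &
      opp_colors (color_list x) = opp_colors (rep v)].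
Proof.
have /allP/(_ (color_list x)) : all (fun l => [&& variety l < 30,
    perm_eq (keys l) (keys (rep (variety l))) &
    opp_colors l == opp_colors (rep (variety l))]) (permutations (iota 0 6)).
  by vm_compute.
by rewrite mem_permutations color_list_perm => /(_ isT)/and3P[-> -> /eqP->].
Qed.

Lemma exists_cube t : t < 30 -> exists x, color_list x = rep t.
Proof.
move=> lt; have /allP/(_ t) : all (fun t => perm_eq (rep t) (iota 0 6)) varieties.
  by vm_compute.
rewrite mem_varieties lt => /(_ isT) pt.
pose g : {ffun face -> color} := [ffun f : face => inord (nth 0 (rep t) (f.1.*2 + f.2))].
have sz : size (rep t) = 6 by rewrite (perm_size pt).
have gP : [forall a : color, exists f : face, g f == a].
  apply/forallP=> a; have a_t : (a : nat) \in rep t.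
    by rewrite (perm_mem pt) mem_iota /=.
  have li : index (a : nat) (rep t) < 6.
    have : index (a : nat) (rep t) < size (rep t) by rewrite index_mem.
    by rewrite sz.
  apply/existsP.
  exists (inord (index (a : nat) (rep t))./2, odd (index (a : nat) (rep t))).
  rewrite ffunE /= inordK; last by rewrite ltn_half_double; exact: leq_trans li _.
  by rewrite addnC odd_double_half nth_index // inord_val.
exists (exist _ g gP).
have in6 i : i < 6 -> (inord (nth 0 (rep t) i) : 'I_6) = nth 0 (rep t) i :> nat.
  move=> li; rewrite inordK //; have : nth 0 (rep t) i \in rep t by rewrite mem_nth ?sz.
  by rewrite (perm_mem pt) mem_iota.
apply: (@eq_from_nth _ 0); rewrite ?sz // => i li.
have -> : i = ((inord i./2 : 'I_3) : nat).*2 + odd i.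
  by rewrite inordK ?ltn_half_double 1?addnC ?odd_double_half.
rewrite (nth_color_list (exist _ g gP) (inord i./2, odd i)) /face_color /= ffunE in6 //.
by rewrite inordK ?ltn_half_double // addnC odd_double_half.
Qed.

Definition sign_key (x : cube) (e : {ffun 'I_3 -> bool}) : seq nat :=
  corner_key (color_list x) (e axis0) (e axis1) (e axis2).

Lemma sign_key_mem x e : sign_key x e \in keys (color_list x).
Proof.
rewrite /sign_key; apply/mapP; exists (e axis0, e axis1, e axis2) => //.
by case: (e axis0); case: (e axis1); case: (e axis2).
Qed.

Lemma mem_keys x k : k \in keys (color_list x) -> exists e, k = sign_key x e.
Proof.
case/mapP=> -[[b0 b1] b2] _ ->.
exists [ffun i : 'I_3 => if i == axis0 then b0 else if i == axis1 then b1 else b2].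
by rewrite /sign_key !ffunE.
Qed.

Lemma sign_key_inj x : injective (sign_key x).
Proof.
have [lv kv _] := variety_spec x.
have uk : uniq (keys (color_list x)).
  rewrite (perm_uniq kv).
  have /allP/(_ (variety (color_list x))) :
    all (fun t => uniq (keys (rep t))) varieties by vm_compute.
  by apply; rewrite mem_varieties.
have inj : injective (fun s : bool * bool * bool =>
    corner_key (color_list x) s.1.1 s.1.2 s.2).
  apply/injectiveP; rewrite /injectiveb /dinjectiveb.
  rewrite (perm_uniq (perm_map _ (_ : perm_eq _ signs))) //.
  by apply: uniq_perm; rewrite ?enum_uniq // => -[[[] []] []]; rewrite mem_enum.
move=> e d /(inj (e axis0, e axis1, e axis2) (d axis0, d axis1, d axis2)) [e0 e1 e2].
by apply/ffunP; apply: axisP.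
Qed.

(** An order of the axes that lists the faces of corner [e] with positive orientation, as in
    [corner_key]. *)
Definition flag (e : {ffun 'I_3 -> bool}) : 'S_3 :=
  if \big[addb/false]_i e i then 1%g else tperm axis0 axis1.

Lemma sign_keyE x e : sign_key x e =
  let c i : nat := face_color x (flag e i, e (flag e i)) in
  key (c axis0) (c axis1) (c axis2).
Proof.
rewrite /sign_key /corner_key.
rewrite -[nth 0 _ (e axis0)]/(nth 0 _ (axis0.*2 + e axis0)).
rewrite -[nth 0 _ (e axis1).+2]/(nth 0 _ (axis1.*2 + e axis1)).
rewrite -[nth 0 _ (e axis2).+4]/(nth 0 _ (axis2.*2 + e axis2)).
rewrite (nth_color_list x (axis0, _)) (nth_color_list x (axis1, _)).
rewrite (nth_color_list x (axis2, _)) /flag big_axes.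
by case: ifP => _ /=; rewrite ?perm1 // tpermL tpermR tpermD.
Qed.

(** Equal keys match the two corners up to a cyclic shift [s], which is even, and all flags have the
    same parity; so the motion between the corners is a rotation. *)
Lemma place_corner (x t : cube) (e : {ffun 'I_3 -> bool}) :
  sign_key t e \in keys (color_list x) -> exists y : cube,
    same_variety x y /\ forall i, face_color y (i, e i) = face_color t (i, e i).
Proof.
case/mem_keys=> d; rewrite !sign_keyE /= => eq_key.
have [s [s_even sP]] : exists s : 'S_3, odd_perm s = false /\ forall i,
    face_color t (flag e i, e (flag e i)) =
    face_color x (flag d (s i), d (flag d (s i))).
  case: (key_rot eq_key) => -[/val_inj c0 /val_inj c1 /val_inj c2].
  - exists 1%g; rewrite odd_perm1; split=> //.
    by apply: axisP; rewrite perm1.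
  - exists (tperm axis0 axis1 * tperm axis0 axis2)%g.
    rewrite odd_permM !odd_tperm; split=> //; apply: axisP; rewrite permM.
    + by rewrite tpermL tpermD.
    + by rewrite tpermR tpermL.
    + by rewrite (@tpermD _ axis0 axis1) // tpermR.
  - exists (tperm axis0 axis2 * tperm axis0 axis1)%g.
    rewrite odd_permM !odd_tperm; split=> //; apply: axisP; rewrite permM.
    + by rewrite tpermL tpermD.
    + by rewrite (@tpermD _ axis0 axis2) // tpermR.
    + by rewrite tpermR tpermL.
have flag_par g : odd_perm (flag g) (+) \big[addb/false]_i g (flag g i) = true.
  have -> : \big[addb/false]_i g (flag g i) = \big[addb/false]_i g i.
    by rewrite [RHS](reindex_inj (@perm_inj _ (flag g))).
  rewrite /flag.
  by case: ifP => _; rewrite ?odd_perm1 // odd_tperm.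
have [|y [xy yP]] := @place_cube x (s * flag d)%g (flag e)
    (fun i => d (flag d (s i))) (fun i => e (flag e i)).
  rewrite flag_par odd_permM s_even addFb -[RHS](flag_par d); congr (_ (+) _).
  by rewrite [RHS](reindex_inj (@perm_inj _ s)).
exists y; split=> // i; have := yP ((flag e)^-1 i)%g.
by rewrite permM -sP permKV.
Qed.

(** * Hall's theorem *)

(** Induction on the size of [A], split according to whether a nonempty proper subset is tight. An
    element of [Y] supplies values outside [A]. *)
Lemma hall_in (X Y : finType) (A : {set X}) (R : X -> {set Y}) :
  (forall S : {set X}, S \subset A -> #|S| <= #|\bigcup_(x in S) R x|) ->
  0 < #|Y| -> exists f : X -> Y, {in A &, injective f} /\ {in A, forall x, f x \in R x}.
Proof.
have [n] := ubnP #|A|; elim: n => // n IHn in A R *; rewrite ltnS => leA hallA Y_gt0.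
have [y0 _] : exists y : Y, y \in Y by apply/card_gt0P.
have [-> | [x xA]] := set_0Vmem A.
  by exists (fun=> y0); split=> [x | x]; rewrite inE.
case: (boolP [exists S : {set X}, [&& S != set0, S \proper A &
    #|\bigcup_(x in S) R x| == #|S|]]).
  case/existsP=> S /and3P[S0 SA /eqP tight].
  have subSA := proper_sub SA.
  have [||f [f_inj fR]] := IHn S R _ _ Y_gt0.
  - exact: leq_trans (proper_card SA) leA.
  - by move=> S' sS'; apply: hallA (subset_trans sS' subSA).
  set N := \bigcup_(x in S) R x in tight.
  (* A tight [S] uses up its neighbourhood [N]; Hall's condition for a union with [S] gives it for
     the rest outside [N]. *)
  have [||g [g_inj gR]] := IHn (A :\: S) (fun x => R x :\: N) _ _ Y_gt0.
  - rewrite cardsD (setIidPr subSA).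
    by have := subset_leq_card subSA; move: S0 leA; rewrite -card_gt0; lia.
  - move=> S' sS'; have dS : [disjoint S' & S].
      by have := sS'; rewrite subsetD => /andP[].
    have sS'A : S' :|: S \subset A.
      by rewrite subUset subSA andbT (subset_trans sS') ?subsetDl.
    have := hallA _ sS'A; rewrite cardsU (disjoint_setI0 dS) cards0 subn0.
    have -> : \bigcup_(x in S' :|: S) R x =
        \bigcup_(x in S') (R x :\: N) :|: N.
      apply/setP=> y; rewrite !inE; apply/bigcupP/orP => [[z]|].
        have [yN|yN] := boolP (y \in N); first by right.
        rewrite inE => /orP[zS' yz | zS yz].
          by left; apply/bigcupP; exists z => //; rewrite inE yN.
        by case/negP: yN; apply/bigcupP; exists z.
      case=> [/bigcupP[z zS'] | /bigcupP[z zS] yz].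
        by rewrite inE => /andP[_ yz]; exists z; rewrite // inE zS'.
      by exists z; rewrite // inE zS orbT.
    by rewrite cardsU tight; lia.
  have fN z : z \in S -> f z \in N by move=> zS; apply/bigcupP; exists z; rewrite ?fR.
  have gN z : z \in A -> z \notin S -> g z \notin N.
    by move=> zA zS; have := gR z; rewrite !inE zS zA => /(_ isT)/andP[].
  exists (fun z => if z \in S then f z else g z); split.
    move=> z w zA wA; case: ifP => zS; case: ifP => wS.
    - exact: f_inj.
    - by move=> e; have := gN w wA; rewrite wS -e fN // => /(_ isT).
    - by move=> e; have := gN z zA; rewrite zS e fN // => /(_ isT).
    - by apply: g_inj; rewrite inE ?zS ?wS.
  move=> z zA; case: ifP => zS; first exact: fR.
  by have := gR z; rewrite !inE zS zA => /(_ isT)/andP[].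
(* Without tight subsets there is slack one everywhere, so any [x] can be matched to any admissible
   [y]. *)
rewrite negb_exists => /forallP loose.
have [y yx] : exists y, y \in R x.
  have := hallA [set x]; rewrite sub1set xA cards1 big_set1 => /(_ isT).
  by case/card_gt0P=> y; exists y.
have [||f [f_inj fR]] := IHn (A :\ x) (fun z => R z :\ y) _ _ Y_gt0.
- by have := cardsD1 x A; rewrite xA; move: leA; lia.
- move=> S sS; have [-> | S0] := eqVneq S set0; first by rewrite cards0.
  have sSA : S \subset A := subset_trans sS (subsetDl _ _).
  have propS : S \proper A.
    rewrite properE sSA; apply/negP => /subsetP/(_ x xA) xS.
    by have := subsetP sS x xS; rewrite !inE eqxx.
  have := loose S; rewrite S0 propS /= => neq.
  have : \bigcup_(z in S) R z \subset y |: \bigcup_(z in S) (R z :\ y).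
    apply/bigcupsP=> z zS; apply/subsetP => w wz; rewrite !inE.
    have [//|wy] := eqVneq w y.
    by apply/bigcupP; exists z; rewrite // !inE wy.
  move/subset_leq_card; rewrite cardsU1; move: neq (hallA S sSA).
  by case: (_ \in _) => /=; lia.
exists (fun z => if z == x then y else f z); split.
  have fy z : z \in A -> z != x -> f z != y.
    by move=> zA zx; have := fR z; rewrite !inE zx zA => /(_ isT)/andP[].
  move=> z w zA wA; have [-> | zx] := eqVneq z x; have [-> | wx] := eqVneq w x => //.
  - by move=> e; have := fy w wA wx; rewrite -e eqxx.
  - by move=> e; have := fy z zA zx; rewrite e eqxx.
  - by apply: f_inj; rewrite !inE ?zx ?wx.
move=> z zA; have [-> //|zx] := eqVneq z x.
by have := fR z; rewrite !inE zx zA => /(_ isT)/andP[].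
Qed.

Lemma hall (X Y : finType) (R : X -> {set Y}) : 0 < #|Y| ->
  (forall S : {set X}, #|S| <= #|\bigcup_(x in S) R x|) ->
  exists2 f : X -> Y, injective f & forall x, f x \in R x.
Proof.
move=> Y_gt0 hallR; have [|f [f_inj fR]] := @hall_in X Y setT R _ Y_gt0.
  by move=> S _; apply: hallR.
by exists f => [x y e | x]; [apply: f_inj | apply: fR].
Qed.

(** * The slots of a frame *)

(* The free axis of an edge, and the signs on the next two axes. *)
Definition edge_class : Type := ('I_3 * bool * bool)%type.

Definition edge_face (E : edge_class) : face := (ordS E.1.1, E.1.2).
Definition edge_face' (E : edge_class) : face := (ordS (ordS E.1.1), E.2).

Definition slot (k : nat) : Type := ({ffun 'I_3 -> bool} + edge_class * 'I_k)%type.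

Definition slot_face k (s : slot k) (d : face) : bool :=
  match s with
  | inl e => d.2 == e d.1
  | inr (E, _) => (d == edge_face E) || (d == edge_face' E)
  end.

Definition fits (x t : cube) (D : pred face) : bool :=
  [exists y : cube, same_variety x y &&
    [forall d, D d ==> (face_color y d == face_color t d)]].

Lemma card_slot k : #|{: slot k}| = 12 * k + 8.
Proof.
by rewrite card_sum card_ffun !card_prod !card_bool !card_ord addnC.
Qed.

Lemma ordS_neq (i : 'I_3) : [/\ ordS i != i, ordS (ordS i) != i & ordS (ordS i) != ordS i].
Proof. by move: i; apply: axisP. Qed.

Lemma ordS3 (i : 'I_3) : ordS (ordS (ordS i)) = i.
Proof. by move: i; apply: axisP; apply: val_inj. Qed.

Lemma ordS_cover (a i : 'I_3) : [|| i == a, i == ordS a | i == ordS (ordS a)].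
Proof. by move: a i; apply: axisP; apply: axisP. Qed.

Lemma edge_face_axis E : (edge_face E).1 != (edge_face' E).1.
Proof. by rewrite eq_sym; case: (ordS_neq E.1.1). Qed.

Lemma edge_face_inj E E' :
  edge_face E = edge_face E' -> edge_face' E = edge_face' E' -> E = E'.
Proof.
case: E E' => [[a b] c] [[a' b'] c'] /eqP; rewrite xpair_eqE.
case/andP=> /eqP/ordS_inj /= -> /eqP /= -> /eqP; rewrite xpair_eqE.
by case/andP=> _ /eqP /= ->.
Qed.

(** The faces of an edge are listed in the cyclic order of their axes, so no pair occurs in both
    orders. *)
Lemma edge_face_cross E E' :
  edge_face E = edge_face' E' -> edge_face' E <> edge_face E'.
Proof.
move=> /(congr1 fst)/= e /(congr1 fst)/= e'; have [] := ordS_neq E'.1.1.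
by rewrite -e' e ordS3 eqxx.
Qed.

(** Distinct colors that are not opposite on [x] lie on different axes, and a rotation can take such
    faces to any two adjacent faces. *)
Lemma fits_edge x t E :
  opp_color (color_list x) (face_color t (edge_face E)) != face_color t (edge_face' E) ->
  fits x t (fun d => (d == edge_face E) || (d == edge_face' E)).
Proof.
move=> neq; have [f fE] := face_color_onto x (face_color t (edge_face E)).
have [f' fE'] := face_color_onto x (face_color t (edge_face' E)).
have ff' : f.1 != f'.1.
  apply: contra neq => /eqP ff'; rewrite -fE -fE' opp_color_face.
  have [e|ne] := eqVneq f.2 f'.2.
    have := edge_face_axis E; rewrite (_ : edge_face E = edge_face' E) ?eqxx //.
    apply: (@face_color_inj t); rewrite -fE -fE'.
    by rewrite [f]surjective_pairing ff' e -surjective_pairing.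
  rewrite ff' [X in _ == nat_of_ord (face_color x X)]surjective_pairing.
  by move: ne; case: f.2; case: f'.2.
have [y [xy yE yE']] := place_edge x ff' (edge_face_axis E).
apply/existsP; exists y; rewrite xy; apply/forallP => d; apply/implyP.
by case/orP=> /eqP ->; rewrite ?yE ?yE' ?fE ?fE'.
Qed.

Lemma fits_corner x t e : sign_key t e \in keys (color_list x) ->
  fits x t (fun d => d.2 == e d.1).
Proof.
case/place_corner=> y [xy yP]; apply/existsP; exists y; rewrite xy.
by apply/forallP=> -[i b]; apply/implyP => /= /eqP ->; rewrite yP.
Qed.

Lemma sum_by_variety N (c : 'I_N -> cube) (P : pred nat)
    (m := fun v => \sum_(i < N) (variety (color_list (c i)) == v : nat)) :
  \sum_(v <- varieties) m v * P v = #|[set i | P (variety (color_list (c i)))]|.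
Proof.
rewrite -sum1_card; under eq_bigr => v _ do rewrite /m big_distrl /=.
rewrite exchange_big [RHS]big_mkcond /=; apply: eq_bigr => i _; rewrite inE.
have [lv _ _] := variety_spec (c i).
rewrite (bigD1_seq (variety (color_list (c i)))) ?varieties_uniq ?mem_varieties //=.
rewrite eqxx mul1n big1 ?addn0 => [|v /negbTE]; first by case: (P _).
by rewrite eq_sym => ->.
Qed.

(** Two opposite pairs leave two colors, which form the third. The check runs over the distinct
    matchings only, whence [undup]. *)
Lemma opp_colors_two v v' a b : v < 30 -> v' < 30 -> a < 6 -> b < 6 ->
  a != b -> opp_color (rep v) a != b ->
  opp_color (rep v) a = opp_color (rep v') a ->
  opp_color (rep v) b = opp_color (rep v') b ->
  opp_colors (rep v) = opp_colors (rep v').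
Proof.
move=> lv lv' la lb ab ob ea eb; rewrite !(opp_colorE _ la, opp_colorE _ lb) in ob ea eb.
pose O := [seq opp_colors (rep v) | v <- varieties].
have OP u : u < 30 -> opp_colors (rep u) \in O.
  by move=> lu; apply/mapP; exists u; rewrite ?mem_varieties.
have : all (fun o => all (fun o' => all (fun a => all (fun b =>
    (a != b) && (nth 0 o a != b) && (nth 0 o a == nth 0 o' a)
    && (nth 0 o b == nth 0 o' b) ==> (o == o')) (iota 0 6)) (iota 0 6))
    (undup O)) (undup O) by vm_compute.
move=> /allP/(_ (opp_colors (rep v))); rewrite mem_undup OP // => /(_ isT).
move=> /allP/(_ (opp_colors (rep v'))); rewrite mem_undup OP // => /(_ isT).
move=> /allP/(_ a); rewrite mem_iota la => /(_ isT).
move=> /allP/(_ b); rewrite mem_iota lb => /(_ isT).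
by rewrite ab ob ea eb !eqxx => /eqP.
Qed.

(** Hall's condition is checked for a set [X] of slots meeting the edges in [F]. If [F] is empty,
    filling the corners suffices; otherwise every cube outside [U] is bad for all of [F], and there
    are few such cubes. *)
Lemma exists_placement k N (c : 'I_N -> cube) : 1 < k -> N = 12 * k + 8 ->
  exists t : cube, exists2 s : slot k -> 'I_N, injective s &
    forall z, fits (c (s z)) t (slot_face z).
Proof.
move=> k_gt1 eqN.
pose code i := variety (color_list (c i)).
pose m v := \sum_(i < N) (code i == v : nat).
have card_code (P : pred nat) : \sum_(v <- varieties) m v * P v = #|[set i | P (code i)]|.
  exact: (sum_by_variety c).
have weight_filter (P : pred nat) :
    weight m [seq v <- varieties | P v] = #|[set i | P (code i)]|.
  rewrite -card_code /weight big_filter big_mkcond /=.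
  by apply: eq_bigr => v _; case: (P v); rewrite ?muln1 ?muln0.
have wm : weight m varieties = 12 * k + 8.
  rewrite -eqN -[varieties]filter_predT weight_filter -[RHS]card_ord.
  by apply: eq_card => i; rewrite !inE.
have [v0 lv0 [fill pencilP matesP]] := exists_good_target k_gt1 wm.
have [t tE] := exists_cube lv0.
have oc_t E : opp_color (rep v0) (face_color t (edge_face E)) !=
    face_color t (edge_face' E).
  rewrite -tE opp_color_face; apply/negP => /eqP/val_inj/face_color_inj e.
  by have := edge_face_axis E; rewrite -e eqxx.
have oc_code i a : a < 6 -> opp_color (rep (code i)) a = opp_color (color_list (c i)) a.
  by move=> la; have [_ _ e] := variety_spec (c i); rewrite !opp_colorE // e.
have lcode i : code i < 30 by have [] := variety_spec (c i).
suff [s s_inj sP] : exists2 s : slot k -> 'I_N, injective s &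
    forall z, s z \in [set i | fits (c i) t (slot_face z)].
  by exists t, s => // z; have := sP z; rewrite inE.
apply: hall => [|X]; first by rewrite card_ord eqN addn_gt0 orbT.
set U := \bigcup_(z in X) _.
pose S := [set e | inl e \in X].
pose F := [set E : edge_class | [exists j, inr (E, j) \in X]].
have leX : #|X| <= #|S| + #|F| * k.
  have sX : X \subset [set inl e | e in S] :|: [set inr z | z in setX F [set: 'I_k]].
    apply/subsetP => -[e | [E j]] zX; rewrite inE; apply/orP; [left | right].
      by apply: imset_f; rewrite inE.
    by apply: imset_f; rewrite !inE andbT; apply/existsP; exists j.
  apply: leq_trans (subset_leq_card sX) _; apply: leq_trans (leq_card_setU _ _) _.
  rewrite leq_add ?leq_imset_card // (leq_trans (leq_imset_card _ _)) //.
  by rewrite cardsX cardsT card_ord.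
have [F0 | [E0 E0F]] := set_0Vmem F.
  apply: leq_trans leX _; rewrite F0 cards0 addn0.
  have uS : uniq [seq sign_key t e | e <- enum S].
    by rewrite map_inj_uniq ?enum_uniq //; apply: sign_key_inj.
  have := fill _ uS; rewrite size_map -cardE card_code => le_S.
  apply: leq_trans (le_S _) _.
    by move=> _ /mapP[e _ ->]; rewrite -tE sign_key_mem.
  apply/subset_leq_card/subsetP => i; rewrite inE => /hasP[_ /mapP[e eS ->] /= ei].
  apply/bigcupP; exists (inl e); first by move: eS; rewrite mem_enum inE.
  rewrite inE fits_corner //; have [_ ki _] := variety_spec (c i).
  by rewrite (perm_mem ki).
pose bad := [set i | [forall E in F,
  opp_color (color_list (c i)) (face_color t (edge_face E)) ==
  face_color t (edge_face' E)]].
have badU : ~: bad \subset U.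
  apply/subsetP => i; rewrite !inE negb_forall => /existsP[E].
  rewrite negb_imply inE => /andP[/existsP[j jX] neq].
  by apply/bigcupP; exists (inr (E, j)); rewrite // inE fits_edge.
have leU : N <= #|bad| + #|U|.
  by rewrite -[X in X <= _]card_ord -(cardsC bad) leq_add2l subset_leq_card.
have le8 : #|S| <= 8 by rewrite (leq_trans (max_card _)) // card_ffun card_bool card_ord.
have [bad0 | [i0 i0_bad]] := set_0Vmem bad.
  move: leU; rewrite bad0 cards0 => leU; apply: leq_trans leU.
  by rewrite eqN -card_slot max_card.
have oc_bad i E : i \in bad -> E \in F ->
    opp_color (color_list (c i)) (face_color t (edge_face E)) =
    face_color t (edge_face' E).
  by rewrite inE => /forallP/(_ E)/implyP iE /iE/eqP.
have /fin_all_exists[g gP] : forall a, exists f, face_color (c i0) f = a.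
  exact: face_color_onto.
have opp_g E : E \in F ->
    face_color t (edge_face' E) = face_color (c i0) ((g (face_color t (edge_face E))).1,
      ~~ (g (face_color t (edge_face E))).2).
  move=> EF; apply/val_inj; rewrite /= -(oc_bad i0) //.
  by rewrite -{1}(gP (face_color t _)) opp_color_face.
(* Send an edge of [F] to the axis of the bad cube [i0] that carries its two colors; this is
   injective. *)
have F3 : #|F| <= 3.
  rewrite -[X in _ <= X](card_ord 3).
  rewrite -(card_in_imset (f := fun E => (g (face_color t (edge_face E))).1)).
    exact: max_card.
  move=> E E' EF E'F /= eqax.
  have [e2 | ne2] := eqVneq (g (face_color t (edge_face E))).2
                            (g (face_color t (edge_face E'))).2.
    apply: edge_face_inj; apply: (@face_color_inj t).
      by rewrite -[LHS]gP -[RHS]gP [g _]surjective_pairing eqax e2 -surjective_pairing.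
    by rewrite !opp_g // eqax e2.
  have e2 : (g (face_color t (edge_face E))).2 = ~~ (g (face_color t (edge_face E'))).2.
    by move: ne2; case: (_.2); case: (_.2).
  case: (@edge_face_cross E E'); apply: (@face_color_inj t).
    by rewrite opp_g // -[LHS]gP -eqax -e2 -surjective_pairing.
  by rewrite opp_g // -[RHS]gP eqax e2 negbK -surjective_pairing.
have bad_le : #|bad| <= (12 - #|F|) * k.
  case: (boolP (F \subset [set E0])) => [FE0 | ].
    have -> : F = [set E0].
      by apply/eqP; rewrite eqEsubset FE0 sub1set.
    rewrite cards1 (leq_trans _ (pencilP _ _ (ltn_ord _) (oc_t E0))) //.
    rewrite weight_filter; apply/subset_leq_card/subsetP => i ibad.
    by rewrite inE oc_code ?ltn_ord // oc_bad.
  case/subsetPn=> E1 E1F; rewrite inE => E10.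
  (* Two edges of [F] prescribe two opposite pairs, so all bad cubes have the matching of [i0],
     which differs from that of [t] because the colors of [E0] are adjacent on [t]. *)
  have le9 : #|bad| <= 9 * k.
    rewrite (leq_trans _ (matesP (code i0) (lcode i0) _)) //; last first.
      apply/negP => /eqP e; have := oc_t E0; rewrite opp_colorE ?ltn_ord // -e.
      by rewrite -opp_colorE ?ltn_ord // oc_code ?ltn_ord // oc_bad // eqxx.
    rewrite weight_filter; apply/subset_leq_card/subsetP => i ibad; rewrite inE.
    apply/eqP; apply: (opp_colors_two (lcode i) (lcode i0)
      (ltn_ord (face_color t (edge_face E0))) (ltn_ord (face_color t (edge_face E1)))).
    - apply: contra E10 => /eqP/val_inj e; apply/eqP/edge_face_inj.
        by apply: (@face_color_inj t).
      apply: (@face_color_inj t); apply: val_inj.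
      by rewrite /= -!(oc_bad i) // e.
    - rewrite oc_code ?ltn_ord // oc_bad //; apply/negP => /eqP/val_inj e.
      case: (@edge_face_cross E1 E0).
        by apply: (@face_color_inj t).
      apply: (@face_color_inj t); apply: val_inj; rewrite /= -(oc_bad i E1) // -e.
      rewrite -(oc_bad i E0) //.
      have [f <-] := face_color_onto (c i) (face_color t (edge_face E0)).
      by rewrite !opp_color_face /= negbK -surjective_pairing.
    - rewrite [LHS](oc_code _ _ (ltn_ord _)) [RHS](oc_code _ _ (ltn_ord _)).
      by rewrite (oc_bad i E0 ibad E0F) (oc_bad i0 E0 i0_bad E0F).
    - rewrite [LHS](oc_code _ _ (ltn_ord _)) [RHS](oc_code _ _ (ltn_ord _)).
      by rewrite (oc_bad i E1 ibad E1F) (oc_bad i0 E1 i0_bad E1F).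
  by rewrite (leq_trans le9) // leq_mul2r; apply/orP; right; lia.
move: leX leU bad_le F3 le8; move: #|F| #|X| #|U| #|S| #|bad| => f x u s b.
move=> leX leU bad_le f3 s8.
(* So [U] has at least f k + 8 cubes, while [X] has at most that many slots. *)
have : (12 - f) * k + f * k = 12 * k by rewrite -mulnDl subnK // (leq_trans f3).
by move: leU; rewrite eqN; lia.
Qed.

(** * Slots as positions of the frame *)

Definition slot_position k (s : slot k) : position k.+2 :=
  match s with
  | inl e => [ffun i => if e i then ord_max else ord0]
  | inr (E, j) => [ffun i => if i == E.1.1 then inord j.+1
      else if (if i == ordS E.1.1 then E.1.2 else E.2) then ord_max else ord0]
  end.

Definition extremal k (p : position k.+2) (i : 'I_3) : bool :=
  (p i == 0 :> nat) || (p i == k.+1 :> nat).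

(** The shift by one keeps the free coordinate strictly between the extremes 0 and k + 1. *)
Lemma slot_position_free k E (j : 'I_k) :
  slot_position (inr (E, j)) E.1.1 = j.+1 :> nat.
Proof. by rewrite ffunE eqxx inordK // !ltnS ltnW. Qed.

Lemma extremal_inl k e i : extremal (slot_position (inl e : slot k)) i.
Proof. by rewrite /extremal ffunE; case: (e i); rewrite /= ?eqxx ?orbT. Qed.

Lemma extremal_inr k E (j : 'I_k) i :
  extremal (slot_position (inr (E, j))) i = (i != E.1.1).
Proof.
have [-> | ni] := eqVneq i E.1.1.
  by rewrite /extremal slot_position_free eqSS orFb (ltn_eqF (ltn_ord j)).
rewrite /extremal ffunE (negbTE ni).
by case: (if i == ordS E.1.1 then E.1.2 else E.2); rewrite /= ?eqxx ?orbT.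
Qed.

Lemma slot_position_edge k (s : slot k) : on_edge (slot_position s).
Proof.
have card_ext (a : 'I_3) (p : position k.+2) :
    (forall i, i != a -> extremal p i) -> on_edge p.
  move=> pP; have : [set~ a] \subset [set i | extremal p i].
    by apply/subsetP => i; rewrite !inE => /pP.
  by move/subset_leq_card; rewrite cardsC1 card_ord.
case: s => [e | [E j]].
  by apply: (card_ext ord0) => i _; apply: extremal_inl.
by apply: (card_ext E.1.1) => i; rewrite extremal_inr.
Qed.

Lemma slot_position_inj k : injective (@slot_position k).
Proof.
have sg (b b' : bool) : (if b then ord_max else ord0) =
    (if b' then ord_max else ord0) :> 'I_k.+2 -> b = b' by case: b; case: b'.
move=> [e | [E j]] [e' | [E' j']] eq_pos.
- congr inl; apply/ffunP => i; apply: sg.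
  by have := congr1 (fun p : position _ => p i) eq_pos; rewrite !ffunE.
- by have := extremal_inl k e E'.1.1; rewrite eq_pos extremal_inr eqxx.
- by have := extremal_inl k e' E.1.1; rewrite -eq_pos extremal_inr eqxx.
have axE : E.1.1 = E'.1.1.
  apply/eqP; rewrite -[_ == _]negbK -(extremal_inr E' j') -eq_pos.
  by rewrite extremal_inr eqxx.
have jj' : j = j'.
  apply/val_inj/succn_inj; rewrite -(slot_position_free E j) eq_pos axE.
  exact: slot_position_free.
have [n1 n2 n3] := ordS_neq E.1.1.
have := congr1 (fun p : position _ => p (ordS E.1.1)) eq_pos.
have := congr1 (fun p : position _ => p (ordS (ordS E.1.1))) eq_pos.
rewrite !ffunE -axE (negbTE n1) (negbTE n2) (negbTE n3) eqxx => /sg e2 /sg e1.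
move: axE e1 e2; case: E E' {eq_pos n1 n2 n3} => [[a b] c] [[a' b'] c'] /= -> -> ->.
by rewrite jj'.
Qed.

Lemma slot_position_onto k (p : position k.+2) : on_edge p ->
  exists s, slot_position s = p.
Proof.
move=> p_edge; have ext_val i : extremal p i ->
    (if p i == k.+1 :> nat then ord_max else ord0) = p i.
  by case/orP=> /eqP e; apply: val_inj; rewrite /= e ?eqxx.
case: (pickP (fun a => ~~ extremal p a)) => [a int_a | ext]; last first.
  exists (inl [ffun i => p i == k.+1 :> nat]); apply/ffunP => i; rewrite !ffunE.
  by apply: ext_val; rewrite -[extremal p i]negbK ext.
(* A second coordinate that is not extremal would leave at most one extremal, against [p_edge]. *)
have ext i : i != a -> extremal p i.
  move=> ia; apply: contraLR p_edge => int_i; rewrite /on_edge -ltnNge ltnS.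
  have : [set i | (p i == 0 :> nat) || (p i == k.+1 :> nat)] \subset [set~ a] :\ i.
    apply/subsetP => j; rewrite !inE => ext_j.
    by apply/andP; split; [apply: contraNneq int_i | apply: contraNneq int_a] => <-.
  move/subset_leq_card => /leq_trans; apply.
  by have := cardsD1 i [set~ a]; rewrite !inE ia cardsC1 card_ord; lia.
have [pa0 pak] : p a <> 0 :> nat /\ p a <> k.+1 :> nat.
  by move: int_a; rewrite negb_or => /andP[/eqP ? /eqP ?].
have lt_pa : (p a).-1 < k by have := ltn_ord (p a); lia.
exists (inr ((a, p (ordS a) == k.+1 :> nat, p (ordS (ordS a)) == k.+1 :> nat),
  Ordinal lt_pa)); apply/ffunP => i; rewrite ffunE /=.
have [-> | ia] := eqVneq i a; first by apply: val_inj; rewrite /= inordK; lia.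
have := ordS_cover a i; rewrite (negbTE ia) /= => cov.
have [ei | ni] := eqVneq i (ordS a); first by rewrite ei ext_val // -ei ext.
move: cov; rewrite (negbTE ni) /= => /eqP ei.
by rewrite ei ext_val // -ei ext.
Qed.

Lemma slot_face_outer k (s : slot k) d :
  on_outer_face d (slot_position s) -> slot_face s d.
Proof.
rewrite /on_outer_face /=; case: s => [e | [E j]].
  by rewrite ffunE /=; case: (e d.1); case: d.2.
case: d => i b /=; have [-> | ni] := eqVneq i E.1.1.
  rewrite slot_position_free; case: b => //=.
  by rewrite eqSS (ltn_eqF (ltn_ord j)).
rewrite ffunE (negbTE ni) /edge_face /edge_face' !xpair_eqE.
have := ordS_cover E.1.1 i; rewrite (negbTE ni) /=.
have [n1 n2 n3] := ordS_neq E.1.1.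
case/orP=> /eqP ->;
  rewrite eqxx ?(negbTE n3) ?(eq_sym (ordS E.1.1)) ?(negbTE n3) /= ?orbF.
  by case: E.1.2; case: b.
by case: E.2; case: b.
Qed.

(** The big cube copies the coloring of [t], which provides the common color of each outer face. *)
Lemma build_frame k N (c : {ffun 'I_N -> cube}) : 1 < k -> N = 12 * k + 8 ->
  can_build k.+2 c.
Proof.
move=> k_gt1 eqN; have [t [s s_inj sP]] := exists_placement c k_gt1 eqN.
have /fin_all_exists[g gP] : forall p : frame k.+2, exists z, slot_position z = val p.
  by move=> p; apply: slot_position_onto (valP p).
have /fin_all_exists[q qP] : forall p : frame k.+2, exists y : cube,
    same_variety (c (s (g p))) y /\
    forall d, slot_face (g p) d -> face_color y d = face_color t d.
  move=> p; have /existsP[y /andP[xy /forallP yP]] := sP (g p).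
  by exists y; split=> // d dp; apply/eqP; have /implyP := yP d; apply.
apply/existsP; exists [ffun p => s (g p)]; apply/existsP; exists [ffun p => q p].
apply/and3P; split.
- apply/injectiveP => p p'; rewrite !ffunE => /s_inj eg.
  by apply: val_inj; rewrite -!gP eg.
- by apply/forallP => p; rewrite !ffunE; case: (qP p).
apply/forallP => d; apply/existsP; exists (face_color t d); apply/forallP => p.
apply/implyP; rewrite -gP ffunE => /slot_face_outer dp.
by case: (qP p) => _ ->.
Qed.

(** The selection is injective on the 12 k + 8 positions; a constant collection serves as the
    instance. *)
Lemma card_frame_ge k N : always_can_build k.+2 N -> 12 * k + 8 <= N.
Proof.
have [x _] := @exists_cube 0 isT.
move=> /forallP/(_ [ffun=> x])/existsP[s /existsP[q /and3P[/injectiveP s_inj _ _]]].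
rewrite -card_slot -[X in _ <= X]card_ord.
pose f (z : slot k) := s (exist _ (slot_position z) (slot_position_edge z)).
by apply: (@leq_card _ _ f) => z z' /s_inj [/slot_position_inj].
Qed.

Theorem theoremB (n : nat) (hn : 4 <= n) : fr n = 12 * n - 16.
Proof.
case: n hn => [|[|k]] // k_gt1; have -> : 12 * k.+2 - 16 = 12 * k + 8 by lia.
rewrite /fr; case: ex_minnP => N buildN minN; apply/eqP; rewrite eqn_leq.
rewrite (card_frame_ge buildN) andbT; apply: minN.
by apply/forallP => c; apply: build_frame.
Qed.
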